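(* Let $c_1,c_2\in\mathbb{N}$. Let $(\Gamma_{1,n})_n$ and $(\Gamma_{2,n})_n$ be two sequences such that, for every $n$, $\Gamma_{1,n}$ and $\Gamma_{2,n}$ are two oriented hypergraphs on $n$ nodes that differ at most by $c_1$ hyperedges of cardinality at most $c_2$. Let $Q$ be one of the operators $A$, $D$, $K$, $L$, and let $\mu_{1,n}:=\mu(Q(\Gamma_{1,n}))$ and $\mu_{2,n}:=\mu(Q(\Gamma_{2,n}))$ be the associated spectral measures. Then $\mu_{1,n}-\mu_{2,n}$ converges weakly-star to $0$ as $n\to\infty$, i.e. for each continuous function $f:\mathbb{R}\to\mathbb{R}$ with compact support, $$\bigl|\mu_{1,n}(f)-\mu_{2,n}(f)\bigr|\longrightarrow 0\quad\text{as } n\to\infty .$$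
   Context: An oriented hypergraph is a triple $\Gamma=(V,H,\psi)$ where $V$ is a finite set of vertices (nodes), $H$ is a finite multiset of nonempty subsets $h\subseteq V$ called hyperedges (repeated hyperedges are distinct elements of $H$), and $\psi:V\times H\to\{-1,0,+1\}$ satisfies $\psi(i,h)\neq 0\iff i\in h$. Two vertices $i\ne j$ are co-oriented in $h$ if $\psi(i,h)=\psi(j,h)\neq0$, and anti-oriented in $h$ if $\psi(i,h)=-\psi(j,h)\neq0$. The degree $\deg(i)$ is the number of hyperedges containing $i$; the cardinality of $h$ is its number of vertices. Standing assumption: no vertex has degree zero. For $\Gamma$ on $n$ vertices: $D(\Gamma)=\mathrm{diag}(\deg(1),\dots,\deg(n))$; $A(\Gamma)$ is the $n\times n$ matrix with $A_{ii}=0$ and, for $i\neq j$, $A_{ij}=\#\{\text{hyperedges in which } i,j \text{ are anti-oriented}\}-\#\{\text{hyperedges in which } i,j\text{ are co-oriented}\}$; $L(\Gamma)=\mathrm{Id}-D^{-1/2}AD^{-1/2}$; $K(\Gamma)=D-A$. All are real symmetric. Two oriented hypergraphs $\Gamma_1=(V,H_1,\psi_{1})$ and $\Gamma_2=(V,H_2,\psi_{2})$ on the same vertex set differ at most by $c$ hyperedges if there are multisets $\hat H,\hat H_1,\hat H_2$ of nonempty subsets of $V$ with $H_1=\hat H\sqcup\hat H_1$, $H_2=\hat H\sqcup\hat H_2$, $\psi_1=\psi_2$ on $V\times\hat H$, and $\#(\hat H_1\cup\hat H_2)\le c$, i.e. at most $c$ hyperedges (counted with multiplicity) in total belong to $\hat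 H_1$ or $\hat H_2$. They differ at most by $c_1$ hyperedges of cardinality at most $c_2$ if this holds with $c=c_1$ and every hyperedge in $\hat H_1$ and $\hat H_2$ has cardinality at most $c_2$. The spectral measure of an $n\times n$ real symmetric matrix $Q$ with eigenvalues $\lambda_1(Q)\le\dots\le\lambda_n(Q)$ is $\mu(Q)=\frac1n\sum_{i=1}^n\delta_{\lambda_i(Q)}$, where $\delta$ denotes the Dirac measure, and $\mu(f):=\int f\,d\mu$. *)

(* Defs.v *)
From HB Require Import structures.
From mathcomp Require Import all_boot all_order all_algebra.
From mathcomp Require Import all_classical all_reals all_analysis.
From mathcomp Require polyrcf.

Set Implicit Arguments.
Unset Strict Implicit.
Unset Printing Implicit Defensive.

Import Order.TTheory GRing.Theory Num.Theory.
Import numFieldNormedType.Exports.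

Local Open Scope ring_scope.

(* The multiset of hyperedges is a finite index type [hedge] with the map
   [verts] to vertex sets; repeated hyperedges are indices with equal image. *)
Record ohypergraph (V : finType) := OHypergraph {
  hedge : finType;
  verts : hedge -> {set V};
  orient : V -> hedge -> int;
  verts_neq0 : forall h, verts h != finset.set0;
  orient_sign : forall i h, orient i h \in [:: -1; 0; 1];
  orient_neq0 : forall i h, (orient i h != 0) = (i \in verts h)
}.

Section Operators.
Context {R : realType} {n : nat}.
Implicit Types (G : ohypergraph 'I_n) (i j : 'I_n).

Definition co_oriented G i j (h : hedge G) : bool :=
  (orient i h == orient j h) && (orient i h != 0).

Definition anti_oriented G i j (h : hedge G) : bool :=
  (orient i h == - orient j h) && (orient i h != 0).

Definition deg G i : nat := #|[set h : hedge G | i \in verts h]|.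

Definition degree_mx G : 'M[R]_n := diag_mx (\row_i (deg G i)%:R).

Definition adjacency_mx G : 'M[R]_n :=
  \matrix_(i, j) if i == j then 0 else
    #|[set h : hedge G | anti_oriented i j h]|%:R
    - #|[set h : hedge G | co_oriented i j h]|%:R.

Definition degree_invsqrt_mx G : 'M[R]_n :=
  diag_mx (\row_i (Num.sqrt (deg G i)%:R)^-1).

Definition laplacian_mx G : 'M[R]_n :=
  1%:M - degree_invsqrt_mx G *m adjacency_mx G *m degree_invsqrt_mx G.

Definition kirchhoff_mx G : 'M[R]_n := degree_mx G - adjacency_mx G.

End Operators.

Inductive operator := OpA | OpD | OpK | OpL.

Definition operator_mx (R : realType) (n : nat) (Q : operator)
    (G : ohypergraph 'I_n) : 'M[R]_n :=
  match Q with
  | OpA => adjacency_mx G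
  | OpD => degree_mx G
  | OpK => kirchhoff_mx G
  | OpL => laplacian_mx G
  end.

(* [H], [H1] and [H2] index the common part and the two remainders; the
   bijections [f1] and [f2] express the disjoint unions of multisets. *)
Definition differ_at_most (V : finType) (c1 c2 : nat)
    (G1 G2 : ohypergraph V) : Prop :=
  exists (H H1 H2 : finType)
         (f1 : H + H1 -> hedge G1) (f2 : H + H2 -> hedge G2),
    [/\ bijective f1 /\ bijective f2,
        forall h, verts (f1 (inl h)) = verts (f2 (inl h)),
        forall i h, orient i (f1 (inl h)) = orient i (f2 (inl h)),
        (#|H1| + #|H2| <= c1)%N &
        (forall h, #|verts (f1 (inr h))| <= c2)%N /\
        (forall h, #|verts (f2 (inr h))| <= c2)%N].

(* The real eigenvalues in nondecreasing order, repeated according to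
   algebraic multiplicity; there are [n] of them when [Q] is symmetric. *)
Definition eigenvalues (R : realType) (n : nat) (Q : 'M[R]_n) : seq R :=
  flatten [seq nseq (mup x (char_poly Q)) x
          | x <- polyrcf.rootsR (char_poly Q)].

Definition spectral_measure (R : realType) (n : nat) (Q : 'M[R]_n) :
    {measure set R -> \bar R} :=
  mscale ((n%:R : R)^-1)%:nng (msum (fun i => dirac (eigenvalues Q)`_i) n).

(* Main.v *)
(* The two operators agree on all entries whose row and column lie outside the
   set S of vertices of the at most c1 exceptional hyperedges, and
   #|S| <= c1 * c2. For two Hermitian matrices agreeing off S the numbers of
   eigenvalues below any threshold differ by at most #|S|, so the sums over the
   two spectra of any fixed step function differ by O(1) as n grows. Since f is
   a uniform limit of step functions, dividing by n gives the convergence. *)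

Require Import Defs.
From mathcomp Require Import all_boot all_order all_algebra.
From mathcomp Require Import all_classical all_reals all_analysis.
From mathcomp Require Import measurable_realfun.
From mathcomp Require polyrcf.
From mathcomp Require Import complex.
From mathcomp Require Import lra zify.
Import Order.TTheory GRing.Theory Num.Theory.
Import numFieldNormedType.Exports.

Set Implicit Arguments.
Unset Strict Implicit.
Unset Printing Implicit Defensive.

Local Open Scope classical_set_scope.
Local Open Scope ring_scope.
Local Open Scope sesquilinear_scope.

(** * Quadratic forms and eigenvalue counts of Hermitian matrices *)

Lemma common_row_kernel (F : fieldType) n (B1 B2 B3 : 'M[F]_n)
    (T1 T2 T3 : {set 'I_n}) : (#|T1| + #|T2| + #|T3| < n)%N ->
  exists2 v : 'rV[F]_n, v != 0 &
    [/\ forall i, i \in T1 -> (v *m B1) 0 i = 0,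
        forall i, i \in T2 -> (v *m B2) 0 i = 0 &
        forall i, i \in T3 -> (v *m B3) 0 i = 0].
Proof.
move=> card_lt.
pose sel (T : {set 'I_n}) (B : 'M[F]_n) := colsub (@enum_val _ (mem T)) B.
(* Each column of [M] is one linear condition on [v]; with fewer than [n] columns, [M] has a nonzero
   left kernel. *)
pose M := row_mx (row_mx (sel T1 B1) (sel T2 B2)) (sel T3 B3).
have : kermx M != 0.
  rewrite -mxrank_eq0 mxrank_ker subn_eq0 -ltnNge.
  by apply: leq_ltn_trans (rank_leq_col _) card_lt.
move=> /rowV0Pn[v /sub_kermxP vM v0]; exists v => //.
move: vM; rewrite !mul_mx_row => /eqP; rewrite !row_mx_eq0.
have sel0 T B : v *m sel T B == 0 -> forall i, i \in T -> (v *m B) 0 i = 0.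
  move=> /eqP/matrixP/(_ 0) vB i iT; move: (vB (enum_rank_in iT i)).
  rewrite !mxE => {2}<-; apply: eq_bigr => j _.
  by rewrite !mxE enum_rankK_in.
by move=> /andP[/andP[/sel0 h1 /sel0 h2] /sel0 h3].
Qed.

Lemma form_diag_mx (C : numClosedFieldType) n (d w : 'rV[C]_n) :
  (w *m diag_mx d *m w^t*) 0 0 = \sum_i d 0 i * `|w 0 i| ^+ 2.
Proof.
rewrite mxE; apply: eq_bigr => i _.
by rewrite mul_mx_diag !mxE normCK mulrCA mulrA.
Qed.

Lemma unitary_dnorm (C : numClosedFieldType) n (P : 'M[C]_n) (v : 'rV[C]_n) :
  P \is unitarymx ->
  \sum_i `|(v *m P^t*) 0 i| ^+ 2 = \sum_i `|v 0 i| ^+ 2.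
Proof.
move=> PU.
have dn (w : 'rV[C]_n) : (w *m w^t*) 0 0 = \sum_i `|w 0 i| ^+ 2.
  by rewrite mxE; apply: eq_bigr => i _; rewrite !mxE normCK.
rewrite -!dn trmx_mul map_mxM map_trmx trmxK -map_mx_comp.
rewrite (map_mx_id (@conjCK _)) mulmxA -(mulmxA v) -invmx_unitary//.
by rewrite mulVmx ?mulmx1// unitarymx_unit.
Qed.

Lemma form_spectral (C : numClosedFieldType) n (A : 'M[C]_n) (v : 'rV[C]_n) :
  A \is normalmx ->
  (v *m A *m v^t*) 0 0 =
  \sum_i spectral_diag A 0 i * `|(v *m (spectralmx A)^t*) 0 i| ^+ 2.
Proof.
move=> /orthomx_spectralP {1}->; rewrite -form_diag_mx.
rewrite invmx_unitary ?spectral_unitarymx//.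
rewrite trmx_mul map_mxM map_trmx trmxK -map_mx_comp.
by rewrite (map_mx_id (@conjCK _)) !mulmxA.
Qed.

(* If the inequality failed, a dimension count would give a nonzero vector that
   vanishes on [S], lies in the span of the eigenvectors of [A] with eigenvalue
   at most [t], and in the span of those of [B] with eigenvalue above [t]: the
   two quadratic forms agree on it, yet they compare differently with [t]. *)
Lemma card_spectral_le (C : numClosedFieldType) n (A B : 'M[C]_n)
    (S : {set 'I_n}) (t : C) :
  A \is hermsymmx -> B \is hermsymmx -> t \is Num.real ->
  (forall i j, i \notin S -> j \notin S -> A i j = B i j) ->
  (#|[pred i | (spectral_diag A 0 i <= t)%R]| <=
   #|[pred i | (spectral_diag B 0 i <= t)%R]| + #|S|)%N.
Proof.
move=> Ah Bh tR AB; rewrite leqNgt; apply/negP => lt.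
have Areal i : spectral_diag A 0 i \is Num.real.
  exact/mxOverP/hermitian_spectral_diag_real.
have Breal i : spectral_diag B 0 i \is Num.real.
  exact/mxOverP/hermitian_spectral_diag_real.
pose TA := finset (fun i => ~~ (spectral_diag A 0 i <= t)).
pose TB := finset (fun i => spectral_diag B 0 i <= t).
have := @common_row_kernel C n ((spectralmx A)^t*) ((spectralmx B)^t*) 1%:M
  TA TB S.
case.
  (* Dimension count: [TA] has [n] minus the count for [A] elements, so the negated inequality [lt]
     says exactly that there are fewer than [n] conditions. *)
  have : (#|[pred i | (spectral_diag A 0 i <= t)%R]| + #|TA| = n)%N.
    rewrite -[RHS](card_ord n) -(cardC [pred i | spectral_diag A 0 i <= t]).
    by rewrite cardsE.
  have cB : #|TB| = #|[pred i | (spectral_diag B 0 i <= t)%R]|.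
    by rewrite cardsE; apply: eq_card.
  move: lt; rewrite -cB; set a := #|[pred i | _]|; move: #|TA| => x; lia.
move=> v v0 [vA vB vS].
have vS0 i : i \in S -> v 0 i = 0 by move=> /vS; rewrite mulmx1.
(* Entries with row or column in [S] are multiplied by a zero coordinate of [v]. *)
have eqAB : v *m A *m v^t* = v *m B *m v^t*.
  apply/matrixP => i0 j0; rewrite !mxE; apply: eq_bigr => j _.
  have [jS|jS] := boolP (j \in S).
    by rewrite !mxE !ord1 vS0// conjC0 !mulr0.
  congr (_ * _); rewrite !mxE; apply: eq_bigr => i _.
  have [iS|iS] := boolP (i \in S); first by rewrite !ord1 vS0// !mul0r.
  by rewrite AB.
have leA : (v *m A *m v^t*) 0 0 <= t * \sum_i `|v 0 i| ^+ 2.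
  rewrite form_spectral ?hermitian_normalmx//.
  rewrite -(unitary_dnorm v (spectral_unitarymx A)) mulr_sumr.
  apply: ler_sum => i _; have [le|nle] := boolP (spectral_diag A 0 i <= t).
    by rewrite ler_wpM2r// exprn_ge0.
  by rewrite vA ?inE// normr0 expr0n !mulr0.
have : t * \sum_i `|v 0 i| ^+ 2 < (v *m B *m v^t*) 0 0.
  rewrite form_spectral ?hermitian_normalmx//.
  rewrite -(unitary_dnorm v (spectral_unitarymx B)) mulr_sumr.
  set w := v *m _.
  (* Strictness needs one nonzero eigencoordinate of [v]; it exists because [spectralmx B] is
     invertible. *)
  have w0 : w != 0.
    apply: contra_neq v0 => /(congr1 (mulmx^~ (spectralmx B))).
    rewrite mul0mx -mulmxA -invmx_unitary ?spectral_unitarymx//.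
    by rewrite mulVmx ?mulmx1 ?spectral_unit.
  have [i wi0] : exists i, w 0 i != 0.
    by move/rV0Pn: w0.
  have ltB j : w 0 j != 0 -> t < spectral_diag B 0 j.
    by apply: contraNT; rewrite real_ltNge// negbK => le; rewrite vB ?inE.
  rewrite (bigD1 i)//= [ltRHS](bigD1 i)//=; apply: ltr_leD.
    by rewrite ltr_pM2r ?ltB// exprn_gt0// normr_gt0.
  apply: ler_sum => j _; have [->|wj] := eqVneq (w 0 j) 0.
    by rewrite normr0 expr0n !mulr0.
  by rewrite ler_wpM2r ?exprn_ge0// ltW// ltB.
by rewrite -eqAB => /lt_le_trans/(_ leA); rewrite ltxx.
Qed.

(** * Real eigenvalues of symmetric matrices through characteristic polynomials *)

Lemma char_poly_conj (F : fieldType) n (P A : 'M[F]_n) :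
  P \in unitmx -> char_poly (invmx P *m A *m P) = char_poly A.
Proof.
move=> Pu; have PVP : map_mx polyC (invmx P) *m map_mx polyC P = 1%:M.
  by rewrite -map_mxM mulVmx// map_mx1.
rewrite /char_poly.
have -> : char_poly_mx (invmx P *m A *m P) =
    map_mx polyC (invmx P) *m char_poly_mx A *m map_mx polyC P.
  rewrite /char_poly_mx mulmxBr mulmxBl -!map_mxM; congr (_ - _).
  by rewrite mul_mx_scalar -scalemxAl PVP scalemx1.
by rewrite !det_mulmx mulrAC -det_mulmx PVP det1 mul1r.
Qed.

Lemma char_poly_spectral (C : numClosedFieldType) n (A : 'M[C]_n) :
  A \is normalmx ->
  char_poly A = \prod_i ('X - (spectral_diag A 0 i)%:P).
Proof.
move=> /orthomx_spectralP {1}->; rewrite char_poly_conj ?spectral_unit//.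
rewrite char_poly_trig ?diag_mx_is_trig//; apply: eq_bigr => i _.
by rewrite mxE eqxx mulr1n.
Qed.

Lemma mup_prod_XsubC (F : fieldType) (s : seq F) x :
  mup x (\prod_(a <- s) ('X - a%:P)) = count_mem x s.
Proof.
elim: s => [|a s IH]; first by rewrite big_nil mupNroot// root1.
rewrite big_cons mupM ?polyXsubC_eq0 ?IH//=; last first.
  by rewrite monic_neq0// monic_prod_XsubC.
by rewrite -['X - a%:P]expr1 mup_XsubCX; case: eqP.
Qed.

(** Both lists contain [x] as often as its multiplicity as a root: [rootsR] has no repetition, so
    each root contributes a single block, and a non-root has multiplicity zero. *)
Lemma eigenvalues_perm (R : realType) n (A : 'M[R]_n) (s : seq R) :
  char_poly A = \prod_(a <- s) ('X - a%:P) -> perm_eq (eigenvalues A) s.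
Proof.
move=> charA; have p0 : char_poly A != 0 by rewrite monic_neq0 ?char_poly_monic.
apply/allP => x _; apply/eqP; rewrite /= /eigenvalues -[in RHS]mup_prod_XsubC.
rewrite -charA count_flatten -map_comp sumnE big_map.
rewrite (eq_bigr (fun y => if y == x then mup x (char_poly A) else 0%N));
  last by move=> y _ /=; rewrite count_nseq /=; case: eqP => [->|];
    rewrite ?mul1n.
rewrite -big_mkcond /= big_const_seq iter_addn_0.
rewrite count_uniq_mem; last exact: lt_sorted_uniq (polyrcf.sorted_roots _ _ _).
have <- : root (char_poly A) x = (x \in polyrcf.rootsR (char_poly A)).
  have /polyrcf.roots_onP/(_ x) := polyrcf.roots_on_rootsR p0.
  by rewrite in_itv /= => /(_ isT).
case: (boolP (root _ x)) => [_|/mupNroot ->]; rewrite ?muln1 ?muln0//.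
Qed.

Definition toC (R : realType) : {rmorphism R -> complex.complex R} :=
  complex.real_complex R.

Lemma map_toC_hermsym (R : realType) n (A : 'M[R]_n) :
  A^T = A -> map_mx (@toC R) A \is hermsymmx.
Proof.
move=> Asym; apply: realsym_hermsym.
  by apply/is_hermitianmxP; rewrite expr0 scale1r map_mx_id// map_trmx Asym.
apply/mxOverP => i j; rewrite mxE.
by apply/complex.complex_realP; exists (A i j).
Qed.

(** The spectral theorem is applied over the complex numbers. The diagonal found there is real, so
    it descends to [R], and so does the factorization of the characteristic polynomial, since
    mapping polynomials along [toC] is injective. *)
Lemma symmetric_spectral (R : realType) n (A : 'M[R]_n) : A^T = A ->
  exists2 d : 'rV[R]_n,
    map_mx (@toC R) d = spectral_diag (map_mx (@toC R) A) &
    perm_eq (eigenvalues A) [seq d 0 i | i : 'I_n].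
Proof.
move=> /map_toC_hermsym AC.
have real i : exists k, spectral_diag (map_mx (@toC R) A) 0 i = toC R k.
  by apply/complex.complex_realP/mxOverP/hermitian_spectral_diag_real.
pose d : 'rV[R]_n := \row_i projT1 (cid (real i)).
have dE : map_mx (@toC R) d = spectral_diag (map_mx (@toC R) A).
  by apply/rowP => i; rewrite !mxE; case: cid.
exists d => //; apply: eigenvalues_perm.
apply: (map_poly_inj (@toC R)); rewrite map_char_poly.
rewrite char_poly_spectral ?hermitian_normalmx// -dE.
rewrite rmorph_prod big_image /=; apply: eq_bigr => i _.
by rewrite mxE rmorphB /= map_polyX map_polyC.
Qed.

(** Up to the factor [n], a bound on the Kolmogorov distance between the empirical distributions of
    [d] and [d']. *)
Definition count_dist_le (R : realType) (k : nat) n (d d' : 'rV[R]_n) :=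
  forall t : R,
    `|\sum_i (d 0 i <= t)%R%:R - \sum_i (d' 0 i <= t)%R%:R| <= k%:R :> R.

Lemma eigenvalues_count_dist_le (R : realType) n (A B : 'M[R]_n)
    (S : {set 'I_n}) (k : nat) : A^T = A -> B^T = B -> (#|S| <= k)%N ->
  (forall i j, i \notin S -> j \notin S -> A i j = B i j) ->
  exists d d' : 'rV[R]_n, [/\ perm_eq (eigenvalues A) [seq d 0 i | i : 'I_n],
    perm_eq (eigenvalues B) [seq d' 0 i | i : 'I_n] & count_dist_le k d d'].
Proof.
move=> Asym Bsym Sk AB.
have [d dC Ad] := symmetric_spectral Asym.
have [d' d'C Bd'] := symmetric_spectral Bsym.
exists d, d'; split => // t.
have AC := map_toC_hermsym Asym; have BC := map_toC_hermsym Bsym.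
have tR : toC R t \is Num.real by apply/complex.complex_realP; exists t.
have cntE (e : 'rV[R]_n) (M : 'M[R]_n) :
    map_mx (@toC R) e = spectral_diag (map_mx (@toC R) M) ->
    \sum_i (e 0 i <= t)%R%:R =
    #|[pred i | (spectral_diag (map_mx (@toC R) M) 0 i <= toC R t)%R]|%:R :> R.
  move=> <-; rewrite -sum1_card natr_sum [RHS]big_mkcond; apply: eq_bigr => i _.
  by rewrite inE mxE /= complex.lecR; case: ifP.
rewrite (cntE _ _ dC) (cntE _ _ d'C).
(* The one-sided bound is used twice, with [A] and [B] exchanged. *)
have := @card_spectral_le _ _ _ _ S _ AC BC tR.
have := @card_spectral_le _ _ _ _ S _ BC AC tR.
set a := #|_|; set b := #|_|.
have ABC i j : i \notin S -> j \notin S ->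
    map_mx (@toC R) A i j = map_mx (@toC R) B i j.
  by move=> iS jS; rewrite !mxE AB.
move=> /(_ (fun i j iS jS => esym (ABC i j iS jS))) ba /(_ ABC) ab.
rewrite ler_norml lerBrDr lerBlDr addrC lerBlDr -!natrD !ler_nat.
by apply/andP; split; [apply: leq_trans ba _|apply: leq_trans ab _];
  rewrite ?leq_add2l// addnC leq_add2r.
Qed.

(** * Integration against spectral measures and approximation by step functions *)

Lemma integral_spectral_measure (R : realType) n (A : 'M[R]_n) (d : 'rV[R]_n)
    (f : R -> R) :
  continuous f -> perm_eq (eigenvalues A) [seq d 0 i | i : 'I_n] ->
  \int[spectral_measure A]_x f x = n%:R^-1 * \sum_i f (d 0 i).
Proof.
(* With exactly [n] eigenvalues, the default value of the indexing in [spectral_measure] is never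
   reached. *)
move=> fc Ad; have sizeA : size (eigenvalues A) = n.
  by rewrite (perm_size Ad) size_image card_ord.
(* The nonnegative case is applied below to the positive and negative parts of [f]. *)
have ge0_int (g : R -> R) : measurable_fun setT g -> (forall x, 0 <= g x) ->
    (\int[spectral_measure A]_x (g x)%:E)%E =
    (n%:R^-1 * \sum_(i < n) g (eigenvalues A)`_i)%:E.
  move=> mg g0; have mEg := (measurable_EFinP setT g).2 mg.
  rewrite /spectral_measure ge0_integral_mscale//; last first.
    by move=> x _; rewrite lee_fin.
  rewrite ge0_integral_measure_sum//; last by move=> x _; rewrite lee_fin.
  rewrite EFinM -sumEFin; congr (_ * _)%E; apply: eq_bigr => i _.
  by rewrite integral_dirac// diracT mul1e.
have mf : measurable_fun setT f by exact: continuous_measurable_fun.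
rewrite /Rintegral integralE (_ : (fun x => (f x)%:E) = EFin \o f)//.
rewrite funerpos funerneg.
rewrite !ge0_int; last 4 first.
- exact: measurable_funrneg.
- exact: funrneg_ge0.
- exact: measurable_funrpos.
- exact: funrpos_ge0.
rewrite /= -mulrBr -sumrB; congr (_ * _).
transitivity (\sum_(i < n) f (eigenvalues A)`_i).
  by apply: eq_bigr => i _; rewrite -[in RHS](funrposBneg f).
transitivity (\sum_(x <- eigenvalues A) f x).
  by rewrite (big_nth 0) sizeA big_mkord.
by rewrite (perm_big _ Ad) /= big_image.
Qed.

(** The bound [C] is uniform in [n], so that it disappears after division by [n]. *)
Definition tame (R : realType) (k : nat) (g : R -> R) :=
  exists C : R, forall n (d d' : 'rV[R]_n), count_dist_le k d d' ->
    `|\sum_i g (d 0 i) - \sum_i g (d' 0 i)| <= C.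

Lemma tame_cst (R : realType) k (c : R) : tame k (fun=> c).
Proof. by exists 0 => n d d' _; rewrite subrr normr0. Qed.

Lemma tame_add_step (R : realType) k (g : R -> R) (c b : R) :
  tame k g -> tame k (fun x => g x + c * (x <= b)%R%:R).
Proof.
move=> [C gC]; exists (C + `|c| * k%:R) => n d d' dd'.
rewrite !big_split /= opprD addrACA -!mulr_sumr -mulrBr.
apply: le_trans (ler_normD _ _) _; apply: lerD; first exact: gC.
by rewrite normrM ler_wpM2l.
Qed.

(* The supremum of the [b] up to which [f] is within [e] of a tame function that
   is constant beyond [b] is attained, and it equals [M] because continuity
   pushes any such [b] a bit further to the right. *)
Lemma tame_approx (R : realType) k (f : R -> R) (M e : R) : continuous f ->
  0 < e -> (forall x, M <= `|x| -> f x = 0) ->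
  exists2 g : R -> R, tame k g & forall x, `|f x - g x| <= e.
Proof.
move=> fc e0 fM.
wlog M0 : M fM / 0 <= M.
  move=> /(_ (Num.max M 0)); apply; last by rewrite le_max lexx orbT.
  by move=> x; rewrite ge_max => /andP[/fM].
pose P b := exists g v, [/\ tame k g, forall x, x <= b -> `|f x - g x| <= e
  & forall x, b < x -> g x = v].
(* One added step at [b] changes the constant value beyond [b] to [c] and leaves [g] as it was up to
   [b]. *)
have switch b c : P b -> exists g, [/\ tame k g,
    forall x, x <= b -> `|f x - g x| <= e & forall x, b < x -> g x = c].
  move=> [g [v [tg gb gv]]].
  exists (fun x => (g x + (c - v)) + (v - c) * (x <= b)%R%:R); split.
  - apply: tame_add_step; case: tg => C gC; exists C => n d d' dd'.
    by rewrite !big_split /= opprD addrACA subrr addr0; apply: gC.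
  - by move=> x xb; rewrite xb mulr1 -[v - c]opprB addrK gb.
  - by move=> x bx; rewrite leNgt bx mulr0 addr0 gv// addrC subrK.
have extend b b' c : b <= b' -> P b ->
    (forall x, b < x -> x <= b' -> `|f x - c| <= e) -> P b'.
  move=> bb' /(switch _ c)[g [tg gb gc]] fb'; exists g, c; split => // x xb'.
    by case: (lerP x b) => [/gb//|bx]; rewrite gc// fb'.
  by rewrite gc// (le_lt_trans bb').
suff /(switch _ 0)[g [tg gM g0]] : P M.
  exists g => // x; case: (lerP x M) => [/gM//|Mx].
  by rewrite g0// fM ?subrr ?normr0 ?ltW// (lt_le_trans Mx)// ler_norm.
have PNM : P (- M).
  exists (fun=> 0), 0; split => //; first exact: tame_cst.
  move=> x xM; rewrite fM ?subrr ?normr0 ?(ltW e0)//.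
  by rewrite -normrN (le_trans _ (ler_norm _))// lerNr.
pose E := [set b | b <= M /\ P b].
have supE : has_sup E.
  split; first by exists (- M); split => //; rewrite (le_trans _ M0)// oppr_le0.
  by exists M => b [].
have cM : sup E <= M by apply: ge_sup; [case: supE|move=> b []].
have /cvgrPdist_le/(_ _ e0)/nbhs_ballP[del /= del0 fdel] := fc (sup E).
have [b [bM Pb] bc] := sup_adherent del0 supE.
have bs : b <= sup E by apply: (sup_upper_bound supE).
(* The cap at [M] keeps [b'] in [E]; with [del / 2], all of the interval from [b] to [b'] lies in
   the ball where [f] is within [e] of [f (sup E)]. *)
pose b' := Num.min M (sup E + del / 2).
have Pb' : P b'.
  apply: (extend b b' (f (sup E))) => //.
    by rewrite le_min bM (le_trans bs)// lerDl divr_ge0// ltW.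
  move=> x bx; rewrite le_min => /andP[_ xs]; rewrite distrC; apply: fdel.
  by rewrite /ball /= ltr_norml; apply/andP; split; lra.
have : b' <= sup E.
  by apply: (sup_upper_bound supE); split => //; rewrite ge_min lexx.
(* The minimum cannot be [sup E + del / 2], which exceeds the supremum, so [b'] is [M]. *)
rewrite /b' ge_min => /orP[Ms|]; last by rewrite gerDl; lra.
by move: Pb'; rewrite /b' min_l// (le_trans Ms)// lerDl divr_ge0// ltW.
Qed.

(** * Operators of hypergraphs that differ by few hyperedges *)

Lemma card_matching (T1 T2 H H1 H2 : finType) (f1 : H + H1 -> T1)
    (f2 : H + H2 -> T2) (p1 : pred T1) (p2 : pred T2) :
  bijective f1 -> bijective f2 ->
  (forall h, p1 (f1 (inl h)) = p2 (f2 (inl h))) ->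
  (forall h, p1 (f1 (inr h)) = false) -> (forall h, p2 (f2 (inr h)) = false) ->
  #|finset p1| = #|finset p2|.
Proof.
move=> f1b f2b p12 p10 p20; rewrite !cardsE -!sum1_card.
rewrite (reindex f1) /=; last exact: onW_bij.
rewrite [RHS](reindex f2) /=; last exact: onW_bij.
(* Both counts split along the disjoint unions: the remainders contribute nothing and the common
   parts match. *)
rewrite !big_sumType /=.
rewrite [X in (_ + X)%N]big_pred0 ?[X in _ = (_ + X)%N]big_pred0//.
by congr addn; apply: eq_bigl => h; exact: p12.
Qed.

Lemma anti_orientedC n (G : ohypergraph 'I_n) i j (h : hedge G) :
  anti_oriented i j h = anti_oriented j i h.
Proof.
rewrite /anti_oriented -[_ == - _]eqr_oppLR [- _ == _]eq_sym.
by case: eqP => //= ->; rewrite oppr_eq0.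
Qed.

Lemma co_orientedC n (G : ohypergraph 'I_n) i j (h : hedge G) :
  co_oriented i j h = co_oriented j i h.
Proof. by rewrite /co_oriented eq_sym; case: eqP => //= ->. Qed.

Lemma adjacency_mx_sym (R : realType) n (G : ohypergraph 'I_n) :
  (adjacency_mx G)^T = adjacency_mx G :> 'M[R]_n.
Proof.
apply/matrixP => i j; rewrite !mxE eq_sym; case: eqP => // _.
by congr (_%:R - _%:R); apply: eq_card => h; rewrite !inE
  1?anti_orientedC 1?co_orientedC.
Qed.

Lemma operator_mx_sym (R : realType) n (Q : operator) (G : ohypergraph 'I_n) :
  (operator_mx R Q G)^T = operator_mx R Q G.
Proof.
case: Q => /=; rewrite /laplacian_mx /kirchhoff_mx.
- exact: adjacency_mx_sym.
- exact: tr_diag_mx.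
- by rewrite linearB /= adjacency_mx_sym tr_diag_mx.
- by rewrite linearB /= !trmx_mul adjacency_mx_sym !tr_diag_mx trmx1 mulmxA.
Qed.

(** A vertex outside the union [S] of the remainder hyperedges has orientation zero in all of them,
    so its degree and orientation counts see only the common part. For each [Q] the entry at [i],
    [j] is determined by the two degrees and the adjacency entry. *)
Lemma differ_at_most_operator_mx (R : realType) n c1 c2
    (G1 G2 : ohypergraph 'I_n) : differ_at_most c1 c2 G1 G2 ->
  exists2 S : {set 'I_n}, (#|S| <= c1 * c2)%N &
    forall Q i j, i \notin S -> j \notin S ->
      operator_mx R Q G1 i j = operator_mx R Q G2 i j.
Proof.
move=> [H [H1 [H2 [f1 [f2 [[f1b f2b] v12 o12 cardH [le1 le2]]]]]]].
pose S1 := (\bigcup_h verts (f1 (inr h)))%SET.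
pose S2 := (\bigcup_h verts (f2 (inr h)))%SET.
exists (S1 :|: S2)%SET.
  have card_bigcup (I : finType) (F : I -> {set 'I_n}) :
      (forall i, #|F i| <= c2)%N -> (#|(\bigcup_i F i)%SET| <= #|I| * c2)%N.
    move=> Fc; rewrite -sum_nat_const.
    apply: (big_ind2 (fun (A : {set 'I_n}) m => #|A| <= m)%N) => //.
      by rewrite cards0.
    move=> A a B b Aa Bb.
    by rewrite (leq_trans (leq_card_setU _ _))// leq_add.
  apply: leq_trans (leq_card_setU _ _) _.
  apply: leq_trans (leq_mul cardH (leqnn c2)).
  by rewrite mulnDl leq_add// card_bigcup.
have notS i : i \notin (S1 :|: S2)%SET ->
    (forall h, orient i (f1 (inr h)) = 0) /\
    (forall h, orient i (f2 (inr h)) = 0).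
  rewrite inE negb_or => /andP[i1 i2]; split => h; apply/eqP.
    rewrite -[_ == _]negbK orient_neq0; apply: contra i1 => ih.
    by apply/bigcupP; exists h.
  rewrite -[_ == _]negbK orient_neq0; apply: contra i2 => ih.
  by apply/bigcupP; exists h.
have degE i : i \notin (S1 :|: S2)%SET -> deg G1 i = deg G2 i.
  move=> /notS[i1 i2]; apply: (card_matching f1b f2b) => h.
  - by rewrite v12.
  - by rewrite -orient_neq0 i1 eqxx.
  - by rewrite -orient_neq0 i2 eqxx.
have adjE i j : i \notin (S1 :|: S2)%SET -> j \notin (S1 :|: S2)%SET ->
    adjacency_mx G1 i j = adjacency_mx G2 i j :> R.
  move=> /notS[i1 i2] _; rewrite !mxE; case: eqP => // _.
  by congr (_%:R - _%:R); apply: (card_matching f1b f2b) => h;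
    rewrite /anti_oriented /co_oriented ?o12 ?i1 ?i2 ?eqxx ?andbF.
move=> Q i j iS jS; case: Q => /=; first exact: adjE.
- by rewrite !mxE degE.
- by have := adjE i j iS jS; rewrite !mxE !degE// => ->.
- rewrite /laplacian_mx !mul_mx_diag !mul_diag_mx.
  by rewrite !mxE !degE//; have := adjE i j iS jS; rewrite !mxE => ->.
Qed.

Theorem theorem5p2 (R : realType) (c1 c2 : nat)
  (G1 G2 : forall n : nat, ohypergraph 'I_n)
  (deg1 : forall (n : nat) (i : 'I_n), (0 < deg (G1 n) i)%N)
  (deg2 : forall (n : nat) (i : 'I_n), (0 < deg (G2 n) i)%N)
  (G12 : forall n : nat, differ_at_most c1 c2 (G1 n) (G2 n))
  (Q : operator) (f : R -> R)
  (f_cont : continuous f)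
  (f_supp : compact (closure [set x : R | f x != 0])) :
  (fun n : nat =>
     `| \int[spectral_measure (operator_mx R Q (G1 n))]_x f x
        - \int[spectral_measure (operator_mx R Q (G2 n))]_x f x |)
    @ \oo --> (0 : R).
Proof.
have [M fM] : exists M, forall x, M <= `|x| -> f x = 0.
  have [M [_ MP]] := compact_bounded f_supp.
  (* [compact_bounded] bounds the support by any number above [M], here [M + 1]; [M + 2] makes the
     contradiction strict. *)
  exists (M + 2) => x Mx; apply: contraTeq isT => fx0.
  have supp_x : closure [set x | f x != 0] x by apply: subset_closure.
  have /(_ x supp_x) /= := MP (M + 1) (ltr_pwDr ltr01 (lexx M)).
  by move: Mx; lra.
apply/cvgrPdist_le => e e0.
(* Two thirds pay for replacing [f] by [g] in each sum, the last one for [C] once [n] is large. *)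
have e3 : 0 < e / 3 by rewrite divr_gt0.
have [g [C gC] fg] := tame_approx (c1 * c2)%N f_cont e3 fM.
near=> n.
have n0 : 0 < n%:R :> R by rewrite ltr0n; near: n; exists 1%N.
have Cn : C <= e / 3 * n%:R.
  by rewrite -ler_pdivrMl// mulrC; near: n; exact: nbhs_infty_ger.
have [S Sc SE] := differ_at_most_operator_mx R (G12 n).
have [d [d' [dA dB dd']]] := eigenvalues_count_dist_le
  (operator_mx_sym R Q (G1 n)) (operator_mx_sym R Q (G2 n)) Sc (SE Q).
move: (operator_mx R Q (G1 n)) (operator_mx R Q (G2 n)) dA dB => A B dA dB.
rewrite sub0r normrN normr_id.
have /= -> := congr2 (fun x y : R => `|x - y|)
  (integral_spectral_measure f_cont dA) (integral_spectral_measure f_cont dB).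
rewrite -mulrBr normrM gtr0_norm ?invr_gt0//.
rewrite ler_pdivrMl//.
have approx (s : 'rV[R]_n) :
    `|\sum_i f (s 0 i) - \sum_i g (s 0 i)| <= e / 3 * n%:R.
  rewrite -sumrB; apply: le_trans (ler_norm_sum _ _ _) _.
  suff <- : \sum_(i < n) e / 3 = e / 3 * n%:R by apply: ler_sum.
  by rewrite sumr_const card_ord mulr_natr.
have := gC _ _ _ dd'; have := approx d; have := approx d'.
rewrite !ler_norml; lra.
Unshelve. all: by end_near.
Qed.
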